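(* Let $k\ge 3$ and $2\le n\le k$. Then $$|G_{n,k}^n|=k^{\binom{k}{n}\cdot n!+1}-k.$$
   Context: $K=\{0,1,\ldots,k-1\}$; $P_k^n$ is the set of all functions $K^n\to K$ in variables $x_1,\ldots,x_n$. A variable $x_i$ is essential in $f$ if changing only the $i$-th argument can change the value of $f$; $Ess(f)$ is the set of essential variables, $ess(f)=|Ess(f)|$. For $i\neq j$, $f_{i\leftarrow j}(a_1,\ldots,a_n)=f(a_1,\ldots,a_{i-1},a_j,a_{i+1},\ldots,a_n)$. $Min(f)$ is the set of all $f_{i\leftarrow j}$ with $i\neq j$ and $x_i,x_j\in Ess(f)$; $gap(f)=ess(f)-\max_{g\in Min(f)}ess(g)$. $G_{p,k}^m=\{f\in P_k^n: ess(f)=m,\ gap(f)=p\}$. *)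

(* Defs.v *)
From mathcomp Require Import all_boot.

Set Implicit Arguments.
Unset Strict Implicit.
Unset Printing Implicit Defensive.

(* Variables x_1, ..., x_n are indexed by 'I_n, and K = 'I_k. *)
Definition args (k n : nat) := {ffun 'I_n -> 'I_k}.

Definition kfun (k n : nat) := {ffun args k n -> 'I_k}.

Definition essential (k n : nat) (f : kfun k n) (i : 'I_n) : bool :=
  [exists a : args k n, exists b : args k n,
    [forall (j : 'I_n | j != i), a j == b j] && (f a != f b)].

Definition Ess (k n : nat) (f : kfun k n) : {set 'I_n} :=
  [set i | essential f i].

Definition ess (k n : nat) (f : kfun k n) : nat := #|Ess f|.

(* identify f i j is f_{i <- j}: the i-th argument is replaced by the j-th. *)
Definition identify (k n : nat) (f : kfun k n) (i j : 'I_n) : kfun k n :=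
  [ffun a : args k n => f [ffun l => if l == i then a j else a l]].

Definition Min (k n : nat) (f : kfun k n) : {set kfun k n} :=
  [set identify f i j | i in Ess f, j in Ess f & i != j].

(* Min f is empty when ess f < 2; the maximum is then 0. The subtraction never
   truncates, since identifying variables creates no new essential variable. *)
Definition gap (k n : nat) (f : kfun k n) : nat :=
  ess f - \max_(g in Min f) ess g.

(* G n p k m is G_{p,k}^m as a subset of P_k^n. *)
Definition G (n p k m : nat) : {set kfun k n} :=
  [set f | (ess f == m) && (gap f == p)].

(* Main.v *)
Require Import Defs.
From mathcomp Require Import all_boot.

Set Implicit Arguments.
Unset Strict Implicit.
Unset Printing Implicit Defensive.

(** A function [f] lies in [G_{n,k}^n] iff all its variables are essential and
    all its identification minors are constant. These constants coincide,
    because every minor takes the value [f (c, ..., c)] at [(c, ..., c)], so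
    [f] is constant on the tuples with a repeated entry. Conversely, let [f] be
    nonconstant but constant on these tuples: at an injective tuple where [f]
    takes another value, replacing any entry by a different one of the tuple
    changes the value, so all variables are essential. Hence [f] is given by a
    nonconstant assignment of values to the [k ^_ n] injective tuples and to one
    further point standing for all the other tuples. *)

Section EssentialVariables.

Variables k n : nat.
Implicit Types (f : kfun k n) (a b : args k n) (i j : 'I_n).

Definition is_constant f := [forall a, forall b, f a == f b].

Lemma is_constantP f : reflect (forall a b, f a = f b) (is_constant f).
Proof.
apply: (iffP forallP) => [h a b|h a]; first exact/eqP/(forallP (h a)).
by apply/forallP => b; rewrite (h a b).
Qed.

Lemma essentialPn f i a b :
  ~~ essential f i -> (forall j, j != i -> a j = b j) -> f a = f b.
Proof.
move=> ne eab; apply/eqP; apply: contraR ne => fab.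
apply/existsP; exists a; apply/existsP; exists b; rewrite fab andbT.
by apply/forall_inP => j /eab ->.
Qed.

Lemma ess_eq0 f : (ess f == 0) = is_constant f.
Proof.
apply/idP/is_constantP => [|cf].
- rewrite cards_eq0 => /eqP E0 a b.
  have ne i : ~~ essential f i by have := in_set0 i; rewrite -E0 inE => ->.
  (* Hybrid tuples from [h 0 = a] to [h n = b]: consecutive ones differ only at coordinate [m],
     which is inessential. *)
  pose h m : args k n := [ffun i : 'I_n => if i < m then b i else a i].
  have hE m : m <= n -> f (h m) = f a.
    elim: m => [_|m IH lt_mn]; first by congr (f _); apply/ffunP=> i; rewrite ffunE.
    rewrite -IH ?(ltnW lt_mn) //.
    apply: (@essentialPn _ (Ordinal lt_mn)) => // j; rewrite -val_eqE /= => nej.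
    by rewrite !ffunE ltnS leq_eqVlt (negbTE nej).
  rewrite -(hE n) //; congr (f _); apply/ffunP => i.
  by rewrite ffunE ltn_ord.
- rewrite cards_eq0; apply/eqP/setP => i; rewrite !inE.
  apply/negbTE/negP => /existsP[a /existsP[b /andP[_]]].
  by rewrite (cf a b) eqxx.
Qed.

(** Since [ess f] is positive, subtracting a positive maximum would strictly decrease it; so every
    minor must have no essential variable. *)
Lemma gap_eq_ess f : 0 < ess f ->
  (gap f == ess f) = [forall g in Min f, is_constant g].
Proof.
move=> f_gt0; rewrite /gap.
have -> : (ess f - \max_(g in Min f) ess g == ess f) =
          (\max_(g in Min f) ess g <= 0).
  case: (\max_(g in Min f) ess g) => [|m]; first by rewrite subn0 eqxx.
  by rewrite ltn_eqF // ltn_subrL.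
apply/bigmax_leqP/forall_inP => h g /h; by rewrite leqn0 ess_eq0.
Qed.

End EssentialVariables.

Section InjectiveExtension.

Variables k n : nat.
Hypotheses (k_gt0 : 0 < k) (n_gt1 : 1 < n).

Definition inj_args := {a : args k n | injectiveb a}.

(* The value at [None] is taken on all non-injective tuples. *)
Definition inj_extend (g : {ffun option inj_args -> 'I_k}) : kfun k n :=
  [ffun a => g (insub a)].

Lemma insub_noninj (a : args k n) i j :
  i != j -> a i = a j -> insub a = None :> option inj_args.
Proof.
move=> neij eij; apply: insubN; apply/negP => /injectiveP inja.
by rewrite (inja _ _ eij) eqxx in neij.
Qed.

Lemma insub_const (c : 'I_k) :
  insub ([ffun=> c] : args k n) = None :> option inj_args.
Proof.
apply: (@insub_noninj _ (Ordinal (ltnW n_gt1)) (Ordinal n_gt1)) => //.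
by rewrite !ffunE.
Qed.

(** Every value of [g] is thus visible in [inj_extend g]; [None] comes from a constant tuple,
    non-injective because [1 < n]. *)
Lemma insub_inj_args_surj (u : option inj_args) :
  exists a : args k n, insub a = u.
Proof.
case: u => [u|]; first by exists (val u); rewrite valK.
by exists [ffun=> Ordinal k_gt0]; rewrite insub_const.
Qed.

Lemma inj_extend_inj : injective inj_extend.
Proof.
move=> g g' e; apply/ffunP => u; have [a <-] := insub_inj_args_surj u.
by move/ffunP/(_ a): e; rewrite !ffunE.
Qed.

Lemma card_inj_args : #|{: inj_args}| = k ^_ n.
Proof.
rewrite card_sig -[in RHS](card_ord k) -[in RHS](card_ord n) -card_inj_ffuns.
by rewrite cardsE.
Qed.

Lemma identify_extend_const g i j : i != j ->
  is_constant (identify (inj_extend g) i j).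
Proof.
move=> neij; apply/is_constantP => a b; rewrite !ffunE.
by rewrite !(insub_noninj neij) // !ffunE eqxx eq_sym (negbTE neij).
Qed.

(** By contraposition: if [i] is inessential, copying another entry into position [i] keeps the
    value but makes the tuple non-injective, so every value is [g None]. *)
Lemma Ess_inj_extend g :
  ~~ is_constant (inj_extend g) -> Ess (inj_extend g) = setT.
Proof.
move=> nc; apply/setP => i; rewrite !inE; apply: contraR nc => nei.
suff gN a : inj_extend g a = g None by apply/is_constantP => a b; rewrite !gN.
have [j neij] : exists j, i != j.
  have [->|ne0] := eqVneq i (Ordinal (ltnW n_gt1)); first by exists (Ordinal n_gt1).
  by exists (Ordinal (ltnW n_gt1)).
pose b : args k n := [ffun l => if l == i then a j else a l].
have -> : inj_extend g a = inj_extend g b.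
  by apply: essentialPn nei _ => l neli; rewrite ffunE (negbTE neli).
by rewrite ffunE (insub_noninj neij) // !ffunE eqxx eq_sym (negbTE neij).
Qed.

Lemma const_minors_extend (f : kfun k n) :
  (forall i j, i != j -> is_constant (identify f i j)) ->
  exists g, f = inj_extend g.
Proof.
move=> cf; pose d : args k n := [ffun=> Ordinal k_gt0].
(* The diagonal tuple [d] represents all non-injective tuples. If [a i = a j], identifying [i] with
   [j] fixes both [a] and [d], so the constant minor gives [f a = f d]. *)
exists [ffun u => f (oapp val d u)]; apply/ffunP => a; rewrite !ffunE.
case: insubP => /= [u _ -> //|/injectivePn[i [j neij eij]]].
have /is_constantP/(_ a d) := cf _ _ neij; rewrite !ffunE.
have -> : [ffun l => if l == i then a j else a l] = a.
  by apply/ffunP => l; rewrite ffunE; case: eqP => // ->.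
move=> ->; congr (f _); apply/ffunP => l.
by rewrite !ffunE; case: ifP.
Qed.

Lemma inj_extend_constant g :
  is_constant (inj_extend g) = (g \in [set [ffun=> c] | c : 'I_k]).
Proof.
apply/is_constantP/imsetP => [cg|[c _ ->] a b]; last by rewrite !ffunE.
exists (g None) => //; apply/ffunP => u; rewrite ffunE.
have [a <-] := insub_inj_args_surj u.
have := cg a [ffun=> Ordinal k_gt0].
by rewrite 2!ffunE insub_const.
Qed.

Lemma G_full_gap :
  G n n k n = inj_extend @: ~: [set [ffun=> c] | c : 'I_k].
Proof.
apply/setP => f; rewrite inE; apply/andP/imsetP => [[/eqP ef gf]|[g]].
- have ef_gt0 : 0 < ess f by rewrite ef ltnW.
  have EfT i : i \in Ess f.
    suff /eqP -> : Ess f == setT by rewrite inE.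
    by rewrite eqEcard subsetT cardsT card_ord /= -/(ess f) ef.
  move: gf; rewrite -[X in _ == X]ef gap_eq_ess // => /forall_inP cM.
  have [i j neij|g fE] := @const_minors_extend f.
    by apply: cM; apply/imset2P; exists i j; rewrite // inE EfT.
  exists g => //; rewrite inE -inj_extend_constant -fE -ess_eq0.
  by rewrite -lt0n.
- rewrite inE -inj_extend_constant => nc ->.
  have ef : ess (inj_extend g) = n by rewrite /ess Ess_inj_extend // cardsT card_ord.
  split; first exact/eqP.
  rewrite -[X in _ == X]ef gap_eq_ess ?ef 1?ltnW //.
  apply/forall_inP => _ /imset2P[i j _ + ->]; rewrite inE => /andP[_ neij].
  exact: identify_extend_const.
Qed.

End InjectiveExtension.

Theorem theorem3p4 (k n : nat) (hk : 3 <= k) (hn2 : 2 <= n) (hnk : n <= k) :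
  #|G n n k n| = k ^ ('C(k, n) * n`! + 1) - k.
Proof.
have k_gt0 : 0 < k by apply: leq_trans hk.
rewrite (G_full_gap k_gt0 hn2) card_imset; last exact: inj_extend_inj.
(* The [+ 1] in the exponent is the point [None]; the subtracted [k] counts the constant
   assignments, told apart by their value at [None]. *)
rewrite cardsCs setCK card_ffun card_option card_inj_args card_ord bin_ffact addn1.
rewrite card_imset ?card_ord // => c d /ffunP/(_ None).
by rewrite !ffunE.
Qed.
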